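(* Let $K$ be a field such that no maximal subring of $K$ is a field. If $K$ has only finitely many maximal subrings up to isomorphism, then $K[x]/(x^2)$ has only finitely many maximal subrings up to isomorphism.
   Context: All rings are commutative with $1\neq 0$; subrings and homomorphisms are unital. Here $x$ is an indeterminate over $K$. A proper subring $S$ of a ring $R$ is a maximal subring of $R$ if it is maximal with respect to inclusion among the proper subrings of $R$. ''Up to isomorphism'' means that subrings are counted up to ring isomorphism. *)

(* Defs.v *)
From HB Require Import structures.
From mathcomp Require Import all_boot all_order all_algebra.

Set Implicit Arguments.
Unset Strict Implicit.
Unset Printing Implicit Defensive.

Import GRing.Theory.
Local Open Scope ring_scope.

(* A unital subring S of R is a subringClosed R, i.e. a predicate on R that
   contains 1 and is closed under subtraction and multiplication; under the
   classical axioms boolean predicates are arbitrary subsets. The next type is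
   S regarded as a ring in its own right. *)
Definition subring_type (R : comNzRingType) (S : subringClosed R) : Type :=
  {x : R | x \in S}.

HB.instance Definition _ (R : comNzRingType) (S : subringClosed R) :=
  SubChoice.copy (subring_type S) {x : R | x \in S}.
HB.instance Definition _ (R : comNzRingType) (S : subringClosed R) :=
  [SubChoice_isSubComNzRing of subring_type S by <:].

Definition is_field (A : comNzRingType) : Prop :=
  forall x : A, x != 0 -> exists y : A, x * y = 1.

Definition ring_isomorphic (A B : comNzRingType) : Prop :=
  exists f : {rmorphism A -> B}, bijective f.

Definition proper_subring (R : comNzRingType) (S : subringClosed R) : Prop :=
  exists x : R, x \notin S.

Definition maximal_subring (R : comNzRingType) (S : subringClosed R) : Prop :=
  proper_subring S /\
  forall T : subringClosed R,
    proper_subring T -> {subset S <= T} -> {subset T <= S}.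

(* The representatives F i need not be pairwise non-isomorphic, and n = 0 is
   allowed: R then has no maximal subring. *)
Definition finitely_many_maximal_subrings_up_to_iso
    (R : comNzRingType) : Prop :=
  exists (n : nat) (F : 'I_n -> subringClosed R),
    (forall i, maximal_subring (F i)) /\
    forall S : subringClosed R, maximal_subring S ->
      exists i, ring_isomorphic (subring_type S) (subring_type (F i)).

(* Main.v *)
Require Import Defs.
From HB Require Import structures.
From mathcomp Require Import all_boot all_order all_algebra.
From mathcomp Require Import boolp ring.

(* Write R = K[x]/(x^2) = K + K e with e^2 = 0, and let S be a maximal subring
   of R. If S contains the ideal K e, then S is the preimage of a maximal
   subring S0 of K under R -> K. As S0 is not a field, maximality gives
   Frac S0 = K, so an isomorphism between two such S0 extends to an automorphism
   of K, hence to R. Otherwise S + K e = R, so the intersection of S and K e is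
   an ideal of R properly contained in the line K e, hence 0, and S is
   isomorphic to R / K e = K. *)

Set Implicit Arguments.
Unset Strict Implicit.
Unset Printing Implicit Defensive.

Import GRing.Theory.
Local Open Scope ring_scope.

(** * Subrings, morphisms and preimages *)

Lemma subring_of_Prop (R : comNzRingType) (P : R -> Prop) :
  P 1 -> (forall x y, P x -> P y -> P (x - y)) ->
  (forall x y, P x -> P y -> P (x * y)) ->
  exists S : subringClosed R, forall x, x \in S <-> P x.
Proof.
move=> P1 PB PM; pose Q : {pred R} := [pred x | `[< P x >]].
have Q_subring : subring_closed Q.
  split=> [|x y /asboolP Px /asboolP Py|x y /asboolP Px /asboolP Py];
    apply/asboolP; [exact: P1 | exact: PB | exact: PM].
pose Qm := GRing.isSubringClosed.Build R Q Q_subring.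
pose S : subringClosed R := HB.pack Q Qm.
by exists S => x; split=> /asboolP.
Qed.

Lemma rmorphism_of_fun (A B : nzRingType) (f : A -> B) :
  zmod_morphism f -> monoid_morphism f ->
  exists g : {rmorphism A -> B}, g =1 f.
Proof.
move=> fB fM.
pose fBm := GRing.isZmodMorphism.Build A B f fB.
pose fMm := GRing.isMonoidMorphism.Build A B f fM.
pose g : {rmorphism A -> B} := HB.pack f fBm fMm.
by exists g.
Qed.

Lemma inj_surj_bijective (A B : Type) (f : A -> B) :
  injective f -> (forall y, exists x, f x = y) -> bijective f.
Proof.
move=> f_inj f_surj; pose g y := projT1 (cid (f_surj y)).
have gK : cancel g f by move=> y; rewrite /g; case: cid.
by exists g => // x; apply: f_inj; rewrite gK.
Qed.

Section Preimage.
Variables (A B : comNzRingType) (f : {rmorphism A -> B}) (S : subringClosed B).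

Definition preim_subring : {pred A} := [pred x | f x \in S].

Fact preim_subring_closed : subring_closed preim_subring.
Proof.
split=> [|x y Sx Sy|x y Sx Sy]; rewrite inE ?rmorph1 ?rpred1 //.
  by rewrite rmorphB rpredB.
by rewrite rmorphM rpredM.
Qed.

HB.instance Definition _ :=
  GRing.isSubringClosed.Build A preim_subring preim_subring_closed.

End Preimage.

Lemma maximal_subring_full (R : comNzRingType) (S T : subringClosed R) (x : R) :
  maximal_subring S -> {subset S <= T} -> x \in T -> x \notin S ->
  forall y, y \in T.
Proof.
move=> [_ maxS] sST Tx nSx y; apply: contraNT nSx => nTy.
by apply: (maxS T) => //; exists y.
Qed.

(** Injectivity is asked on [S] only, so that [g] may have a kernel in [A]: one application takes
    the projection [i \o p], which kills K e. *)
Lemma subring_isomorphic (A B : comNzRingType) (g : {rmorphism A -> B})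
    (S : subringClosed A) (T : subringClosed B) :
  {in S, forall x, g x \in T} ->
  {in S, forall x, g x = 0 -> x = 0} ->
  {in T, forall y, exists2 x, x \in S & g x = y} ->
  ring_isomorphic (subring_type S) (subring_type T).
Proof.
move=> gST g_inj g_surj.
pose f (s : subring_type S) : subring_type T := Sub (g (val s)) (gST _ (valP s)).
have fE s : val (f s) = g (val s) by rewrite SubK.
have [||h hE] := @rmorphism_of_fun _ _ f.
- by move=> s t; apply: val_inj; rewrite rmorphB !fE !rmorphB.
- split=> [|s t]; apply: val_inj; first by rewrite fE !rmorph1.
  by rewrite rmorphM !fE !rmorphM.
exists h; apply: (eq_bij _ (fsym hE)).
apply: inj_surj_bijective => [s t|t].
  move=> /(congr1 val); rewrite !fE => eq_st; apply/val_inj/eqP.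
  rewrite -subr_eq0; apply/eqP/g_inj; first exact: rpredB (valP s) (valP t).
  by rewrite rmorphB eq_st subrr.
have [x Sx gx] := g_surj _ (valP t).
by exists (Sub x Sx); apply: val_inj; rewrite fE SubK.
Qed.

(** * Fractions and extension of isomorphisms to the field *)

Section Fractions.

Variables (K L : fieldType) (A : comNzRingType).
Variables (j : {rmorphism A -> K}) (h : {rmorphism A -> L}).
Hypothesis j_frac : forall a, exists s t, j t != 0 /\ a = j s / j t.
Hypothesis j_inj : injective j.
Hypothesis h_inj : injective h.

(** Send a fraction of [s] by [t] to [h s / h t]. An equality of fractions in [K], cross-multiplied,
    descends to [A] because [j] is injective, so the chosen representatives do not matter;
    injectivity of [h] keeps the denominators nonzero. *)
Lemma rmorphism_extension :
  exists g : {rmorphism K -> L}, forall s, g (j s) = h s.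
Proof.
have [n nP] := choice j_frac.
have [d ndP] := choice nP.
pose g a := h (n a) / h (d a).
have h_neq0 t : j t != 0 -> h t != 0.
  by rewrite !raddf_eq0.
have gE s t : j t != 0 -> g (j s / j t) = h s / h t.
  move=> jt; have [jd eq_st] := ndP (j s / j t); rewrite /g.
  move/eqP: eq_st; rewrite eqr_div // -!rmorphM => /eqP/j_inj eq_st.
  apply/eqP; rewrite eqr_div ?h_neq0 // -!rmorphM.
  by rewrite -eq_st.
have gj s : g (j s) = h s.
  have := gE s 1; rewrite !rmorph1 !divr1; apply; exact: oner_neq0.
have [||f fE] := @rmorphism_of_fun _ _ g.
- move=> a b; have [da ea] := ndP a; have [db eb] := ndP b.
  have -> : a - b = j (n a * d b - n b * d a) / j (d a * d b).
    by rewrite {1}ea {1}eb rmorphB !rmorphM; field; rewrite da db.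
  rewrite gE; last by rewrite rmorphM mulf_neq0.
  by rewrite /g rmorphB !rmorphM; field; rewrite !h_neq0.
- split=> [|a b]; first by rewrite -(rmorph1 j) gj rmorph1.
  have [da ea] := ndP a; have [db eb] := ndP b.
  have -> : a * b = j (n a * n b) / j (d a * d b).
    by rewrite {1}ea {1}eb !rmorphM mulf_div.
  rewrite gE; last by rewrite rmorphM mulf_neq0.
  by rewrite /g !rmorphM mulf_div.
by exists f => s; rewrite fE gj.
Qed.

End Fractions.

(** The fractions form a subring containing [S]. Since [S] is not a field, it has a nonzero element
    whose inverse lies outside [S]; that inverse is a fraction, so by maximality the fractions fill
    [K]. *)
Lemma maximal_subring_fractions (K : fieldType) (S : subringClosed K) :
  maximal_subring S -> ~ is_field (subring_type S) ->
  forall a, exists s t : subring_type S, val t != 0 /\ a = val s / val t.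
Proof.
move=> maxS nfS.
pose P a := exists s t : subring_type S, val t != 0 /\ a = val s / val t.
have P1 : P 1 by exists 1, 1; rewrite rmorph1 oner_neq0 divr1.
have PB a b : P a -> P b -> P (a - b).
  move=> [s [t [t0 ->]]] [s' [t' [t0' ->]]].
  exists (s * t' - s' * t), (t * t').
  rewrite rmorphB !rmorphM mulf_neq0 //; split=> //; field.
  exact/andP.
have PM a b : P a -> P b -> P (a * b).
  move=> [s [t [t0 ->]]] [s' [t' [t0' ->]]].
  by exists (s * s'), (t * t'); rewrite !rmorphM mulf_neq0 // mulf_div.
have [T TP] := subring_of_Prop P1 PB PM.
have [x x0 xV] : exists2 x : subring_type S, x != 0 & (val x)^-1 \notin S.
  apply: contra_notP nfS => noinv x x0.
  have Sx : (val x)^-1 \in S by apply/negPn/negP => nSx; apply: noinv; exists x.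
  exists (Sub (val x)^-1 Sx); apply: val_inj.
  by rewrite rmorphM rmorph1; apply: mulfV; rewrite raddf_eq0 //; apply: val_inj.
have x0' : val x != 0 by rewrite raddf_eq0 //; apply: val_inj.
move=> a; apply/TP; apply: (maximal_subring_full maxS _ _ xV).
  move=> s Ss; apply/TP; exists (Sub s Ss), 1.
  by rewrite rmorph1 oner_neq0 SubK divr1.
by apply/TP; exists 1, x; rewrite rmorph1 div1r.
Qed.

Lemma isomorphism_extension (K : fieldType) (S T : subringClosed K) :
  maximal_subring S -> ~ is_field (subring_type S) ->
  maximal_subring T -> ~ is_field (subring_type T) ->
  ring_isomorphic (subring_type S) (subring_type T) ->
  exists g : {rmorphism K -> K},
    (forall a, (g a \in T) = (a \in S)) /\ forall b, exists a, g a = b.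
Proof.
move=> maxS nfS maxT nfT [f [f' fK f'K]].
have valfI : injective (val \o f : {rmorphism subring_type S -> K}).
  by move=> s t /val_inj/(can_inj fK).
have [g gE] := rmorphism_extension
  (maximal_subring_fractions maxS nfS) val_inj valfI.
have gT b : b \in T -> exists2 a, a \in S & g a = b.
  move=> Tb; exists (val (f' (Sub b Tb))); first exact: valP.
  by rewrite gE /= f'K SubK.
exists g; split=> [a|b].
  (* If [g a] lies in [T], it is also [g a'] with [a'] in [S], and a morphism of fields is
     injective. *)
  apply/idP/idP => [/gT[a' Sa' /fmorph_inj <-] // | Sa].
  by rewrite (gE (Sub a Sa) : g a = _) /=; apply: valP.
(* Surjectivity: [b] is a fraction of elements of [T], each of which has a preimage in [S]. *)
have [s [t [_ ->]]] := maximal_subring_fractions maxT nfT b.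
have [a _ <-] := gT _ (valP s); have [a' _ <-] := gT _ (valP t).
by exists (a / a'); rewrite fmorph_div.
Qed.

(** * Maximal subrings of the dual numbers *)

Section DualNumbers.

(** The ring K + K e through its coordinates: [p] is the projection modulo e, [i] the embedding of
    scalars, [c] the coefficient of [e]. This keeps polynomials out of the argument. *)
Variables (K : fieldType) (R : comNzRingType).
Variables (p : {rmorphism R -> K}) (i : {rmorphism K -> R}) (c : R -> K) (e : R).
Hypothesis iK : cancel i p.
Hypothesis decomp : forall u, u = i (p u) + i (c u) * e.
Hypothesis cE : forall a b, c (i a + i b * e) = b.
Hypothesis ee : e * e = 0.

(** A field has no nonzero nilpotent element. *)
Lemma p_e : p e = 0.
Proof.
by have /(congr1 p)/eqP := ee; rewrite rmorphM rmorph0 mulf_eq0 orbb => /eqP.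
Qed.

Lemma p_dual a b : p (i a + i b * e) = a.
Proof. by rewrite rmorphD rmorphM p_e mulr0 addr0 iK. Qed.

Lemma c_i a : c (i a) = 0.
Proof. by rewrite -[i a]addr0 -(mul0r e) -(rmorph0 i) cE. Qed.

Lemma cB u v : c (u - v) = c u - c v.
Proof.
rewrite {1}(decomp u) {1}(decomp v).
by rewrite opprD addrACA -mulrBl -!(rmorphB i) cE.
Qed.

Lemma dualM a b a' b' :
  (i a + i b * e) * (i a' + i b' * e) = i (a * a') + i (a * b' + b * a') * e.
Proof.
rewrite rmorphD !rmorphM.
transitivity (i a * i a' + (i a * i b' + i b * i a') * e + i b * i b' * (e * e)).
  ring.
by rewrite ee mulr0 addr0.
Qed.

Lemma cM u v : c (u * v) = p u * c v + c u * p v.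
Proof. by rewrite {1}(decomp u) {1}(decomp v) dualM cE. Qed.

(** This is the image of [i], a copy of [K] complementary to K e; it represents all maximal subrings
    that do not contain K e. *)
Definition constants : {pred R} := [pred u | c u == 0].

Fact constants_subring_closed : subring_closed constants.
Proof.
split=> [|u v /eqP cu /eqP cv|u v /eqP cu /eqP cv]; rewrite inE.
- by rewrite -(rmorph1 i) c_i.
- by rewrite cB cu cv subrr.
- by rewrite cM cu cv mulr0 mul0r addr0.
Qed.

Definition constant_subring : subringClosed R :=
  HB.pack constants
    (GRing.isSubringClosed.Build R constants constants_subring_closed).

(** A subring containing the scalars and some [u] with [c u] nonzero contains [e], after subtracting
    [i (p u)] and rescaling, hence everything. *)
Lemma constant_subring_maximal : maximal_subring constant_subring.
Proof.
split=> [|T [x nTx] sCT u Tu].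
  by exists e; rewrite inE -[e]add0r -(mul1r e) -(rmorph0 i) -(rmorph1 i) cE
    oner_neq0.
have Ti a : i a \in T by apply: sCT; rewrite inE c_i.
apply: contraNT nTx; rewrite inE => cu.
have Te : e \in T.
  have -> : e = i (c u)^-1 * (u - i (p u)).
    by rewrite {2}(decomp u) addrC addKr mulrA -rmorphM mulVf // rmorph1 mul1r.
  by rewrite rpredM ?rpredB.
by rewrite (decomp x) rpredD ?rpredM.
Qed.

(** A subring containing K e is determined by the scalars in it: [v] belongs to it exactly when
    [i (p v)] does. So inclusions above the preimage can be tested in [K]. *)
Lemma preim_subring_maximal (S : subringClosed K) :
  maximal_subring S -> maximal_subring (preim_subring p S).
Proof.
move=> [[a nSa] maxS]; split=> [|T [x nTx] sST u Tu].
  by exists (i a); rewrite inE iK.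
have Te b : i b * e \in T by apply: sST; rewrite inE rmorphM p_e mulr0 rpred0.
have Tp v : (i (p v) \in T) = (v \in T).
  by rewrite {2}(decomp v) rpredDr.
rewrite inE; apply: (maxS (preim_subring i T)); last by rewrite inE Tp.
  by exists (p x); rewrite inE Tp.
by move=> b Sb; rewrite inE; apply: sST; rewrite inE iK.
Qed.

(** The converse half of the correspondence; as [S] contains K e, its trace on the scalars is also
    its image under [p]. *)
Lemma maximal_subring_preim (S : subringClosed R) :
  maximal_subring S -> (forall b, i b * e \in S) ->
  maximal_subring (preim_subring i S).
Proof.
move=> [[x nSx] maxS] Se.
have Sp v : (i (p v) \in S) = (v \in S) by rewrite {2}(decomp v) rpredDr.
split=> [|T [a nTa] sST b Tb]; first by exists (p x); rewrite inE Sp.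
rewrite inE; apply: (maxS (preim_subring p T)); last by rewrite inE iK.
  by exists (i a); rewrite inE iK.
by move=> u Su; rewrite inE sST // inE Sp.
Qed.

Lemma extension_isomorphic (S : subringClosed R) (S0 : subringClosed K) :
  maximal_subring S -> (forall b, i b * e \in S) ->
  ~ is_field (subring_type (preim_subring i S)) ->
  maximal_subring S0 -> ~ is_field (subring_type S0) ->
  ring_isomorphic (subring_type (preim_subring i S)) (subring_type S0) ->
  ring_isomorphic (subring_type S) (subring_type (preim_subring p S0)).
Proof.
move=> maxS Se nfS maxS0 nfS0 isoS.
have [g [gS g_surj]] :=
  isomorphism_extension (maximal_subring_preim maxS Se) nfS maxS0 nfS0 isoS.
have Sp v : (i (p v) \in S) = (v \in S) by rewrite {2}(decomp v) rpredDr.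
(* The automorphism [g] of [K], applied to both coordinates, is a ring morphism of [R] fixing
   [e]. *)
pose G u := i (g (p u)) + i (g (c u)) * e.
have [||h hE] := @rmorphism_of_fun _ _ G.
- move=> u v; rewrite /G cB !rmorphB /=; ring.
- split=> [|u v].
    by rewrite /G -(rmorph1 i) c_i iK rmorph0 rmorph1 rmorph0 mul0r addr0.
  by rewrite /G cM dualM !(rmorphM, rmorphD).
have memG u : (h u \in preim_subring p S0) = (u \in S).
  by rewrite inE hE p_dual gS inE Sp.
apply: (@subring_isomorphic _ _ h) => [u Su|u _|u Su].
- by rewrite memG.
- rewrite hE => Gu0; rewrite (decomp u).
  have /(congr1 p) := Gu0; rewrite p_dual rmorph0 => /eqP.
  rewrite fmorph_eq0 => /eqP ->.
  have /(congr1 c) := Gu0; rewrite cE -(rmorph0 i) c_i => /eqP.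
  by rewrite fmorph_eq0 => /eqP ->; rewrite rmorph0 mul0r addr0.
have [a ga] := g_surj (p u); have [b gb] := g_surj (c u).
have hu : h (i a + i b * e) = u by rewrite hE /G p_dual cE ga gb -decomp.
by exists (i a + i b * e) => //; rewrite -memG hu.
Qed.

Lemma complement_isomorphic (S : subringClosed R) (b : K) :
  maximal_subring S -> i b * e \notin S ->
  ring_isomorphic (subring_type S) (subring_type constant_subring).
Proof.
move=> maxS nSb.
(* [T] is S + K e, described as the elements that agree modulo e with an element of [S]. *)
have [|||T TP] := @subring_of_Prop R (fun u => exists2 s, s \in S & p s = p u).
- by exists 1; rewrite ?rpred1.
- move=> u v [s Ss ps] [t St pt].
  by exists (s - t); rewrite ?rpredB // !rmorphB /= ps pt.
- move=> u v [s Ss ps] [t St pt].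
  by exists (s * t); rewrite ?rpredM // !rmorphM /= ps pt.
have p_surj u : exists2 s, s \in S & p s = p u.
  apply/TP; apply: (maximal_subring_full maxS _ _ nSb).
    by move=> s Ss; apply/TP; exists s.
  by apply/TP; exists 0; rewrite ?rpred0 // rmorphM p_e mulr0 rmorph0.
apply: (@subring_isomorphic _ _ (i \o p)) => [s Ss|s Ss|u /eqP cu] /=.
- by rewrite inE c_i.
- move=> /eqP; rewrite fmorph_eq0 => /eqP ps.
  apply: contraNeq nSb => s0.
  have sE : s = i (c s) * e by rewrite {1}(decomp s) ps rmorph0 add0r.
  have cs : c s != 0.
    by apply: contraNneq s0 => cs; rewrite sE cs rmorph0 mul0r.
  (* A nonzero [s] in the intersection of [S] and K e would yield all of K e: since e squares to 0,
     multiplying [s] by [t] only rescales its coefficient by [p t], here chosen to turn [c s] into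
     [b]. *)
  have [t St pt] := p_surj (i (b / c s)).
  have -> : i b * e = t * s.
    by rewrite (decomp (t * s)) cM rmorphM ps pt iK !mulr0 addr0 rmorph0 add0r
      divfK.
  by rewrite rpredM.
- have [s Ss ps] := p_surj u; exists s => //.
  by rewrite ps {2}(decomp u) cu rmorph0 mul0r addr0.
Qed.

Lemma dual_numbers_finitely_many_maximal_subrings :
  (forall S : subringClosed K,
     maximal_subring S -> ~ is_field (subring_type S)) ->
  finitely_many_maximal_subrings_up_to_iso K ->
  finitely_many_maximal_subrings_up_to_iso R.
Proof.
move=> nf [n [F [maxF isoF]]].
(* Index [ord0] is reserved for the constants; the other [n] indices carry the preimages of the
   representatives in [K]. *)
exists n.+1, (fun k => if unlift ord0 k is Some l
  then preim_subring p (F l) : subringClosed R else constant_subring).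
split=> [k|S maxS].
  case: unlift => [l|]; first exact: preim_subring_maximal.
  exact: constant_subring_maximal.
have [Se|/existsNP[b /negP nSb]] := pselect (forall b, i b * e \in S).
  have maxS0 := maximal_subring_preim maxS Se.
  have [l isoS] := isoF _ maxS0; exists (lift ord0 l); rewrite liftK.
  by apply: extension_isomorphic => //; apply: nf.
by exists ord0; rewrite unlift_none; apply: complement_isomorphic nSb.
Qed.

End DualNumbers.

(** * Coefficients modulo a power of the indeterminate *)

Lemma coef_in_qpolyXn (A : comNzRingType) (n k : nat) (q : {poly A}) :
  (in_qpoly 'X^(n.+1) q : {poly A})`_k = if (k < n.+1)%N then q`_k else 0.
Proof.
(* ['X^(n.+1)] is monic and nonconstant, so [mk_monic] leaves it unchanged, and the remainder modulo
   it is a truncation. *)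
by rewrite /in_qpoly /= mk_monic_Xn -Pdiv.RingMonic.take_poly_rmodp
  coef_take_poly.
Qed.

Theorem theorem3p17 (K : fieldType) :
  (forall S : subringClosed K,
     maximal_subring S -> ~ is_field (subring_type S)) ->
  finitely_many_maximal_subrings_up_to_iso K ->
  finitely_many_maximal_subrings_up_to_iso {poly %/ ('X^2 : {poly K})}.
Proof.
set h : {poly K} := 'X^2.
have coef_in q k : (in_qpoly h q : {poly K})`_k = if (k < 2)%N then q`_k else 0.
  exact: coef_in_qpolyXn.
have coefM (u v : {poly %/ h}) k : (u * v : {poly %/ h})`_k =
    if (k < 2)%N then ((u : {poly K}) * v)`_k else 0.
  exact: coef_in.
(* Residue classes are stored as polynomials of size at most 2, so later coefficients take the
   default value 0. *)
have coef_ge2 (u : {poly %/ h}) k : u`_k.+2 = 0.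
  rewrite nth_default // -ltnS (leq_trans (size_mk_monic u)) //.
  by rewrite mk_monic_Xn size_polyXn.
have coef_dual a b k :
    (in_qpoly h a%:P + in_qpoly h b%:P * 'qX)`_k = (a%:P + b%:P * 'X)`_k.
  rewrite -in_qpolyM -in_qpolyD coef_in; case: k => [|[|k]] //=.
  by rewrite coefD coefC coefMX coefC addr0.
have [||p pE] := @rmorphism_of_fun {poly %/ h} K (fun u => u`_0).
- by move=> u v; rewrite /= coefB.
- split=> [|u v] /=; first by rewrite coefC.
  by rewrite coefM coef0M.
(* The coordinates are the coefficients of degree 0 and 1, and e is the class of the
   indeterminate. *)
apply: (@dual_numbers_finitely_many_maximal_subrings K {poly %/ h} p
  (in_qpoly h \o polyC) (fun u => u`_1) 'qX) => [a|u|a b|] /=.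
- by rewrite pE coef_in coefC.
- apply/npolyP => k; rewrite coef_dual pE coefD coefC coefMX coefC.
  by case: k => [|[|k]] /=; rewrite ?addr0 ?add0r ?coef_ge2.
- by rewrite coef_dual coefD coefC coefMX coefC add0r.
- rewrite -in_qpolyM; apply/npolyP => k.
  by rewrite coef_in -expr2 coefXn coef0; case: k => [|[|k]].
Qed.
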